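(* Let $m$ and $F$ be positive integers. If $F\geq 3$, $m\leq\frac{F+2}{2}$ and $m\nmid F$, then there exists a unique irreducible numerical semigroup $C(m,F)$ with Frobenius number $F$, multiplicity $m$ and ratio greater than $\frac F2$. Moreover: (a) If $F$ is odd and $1\leq r\leq m$ is the smallest integer such that $\frac{F+1}{2}$ is congruent to $r$ modulo $m$, then $C(m,F)$ is a numerical semigroup with minimal system of generators $$\{m\}\cup\Big\{\tfrac{F+1}{2}+x \;\Big|\; x\in\{0,\ldots,m-1\}\setminus\{m-r,\,r-1\}\Big\}.$$ (b) If $F$ is even and $1\leq r\leq m$ is the smallest integer such that $\frac{F+2}{2}$ is congruent to $r$ modulo $m$, then $C(m,F)$ is a numerical semigroup with minimal system of generators $\{3,\frac F2+3,F+3\}$, if $m=3$, or $$\{m\}\cup\Big\{\tfrac{F+2}{2}+x \;\Big|\; x\in\{0,\ldots,m-1\}\setminus\{m-r,\,r-2\}\Big\},$$ if $m\neq 3$.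
   Context: $\mathbb N$ denotes the non-negative integers. A numerical semigroup is a submonoid $S$ of $(\mathbb N,+)$ with $\mathbb N\setminus S$ finite. Its multiplicity $\operatorname{m}(S)$ is the smallest positive integer in $S$; its Frobenius number is the largest integer not in $S$. A numerical semigroup is irreducible if it cannot be expressed as the intersection of two numerical semigroups properly containing it. The ratio $\operatorname{r}(S)$ of a numerical semigroup $S$ is the smallest element of $S\setminus\langle\operatorname{m}(S)\rangle$, where $\langle \operatorname{m}(S)\rangle$ is the set of non-negative multiples of $\operatorname{m}(S)$. The minimal system of generators of $S$ is the unique generating set of the monoid $S$ no proper subset of which generates $S$. The notation $m\nmid F$ means that $m$ does not divide $F$.
   Formalization: Part (a) is stated only for m ≠ 2: for m = 2 and F odd the displayed set reduces to {2}, which generates only even numbers, whereas C(2,F) = ⟨2, F+2⟩; existence and uniqueness are still claimed for m = 2. *)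

(* Defs.v *)
From mathcomp Require Import all_boot.
From mathcomp Require Import classical_sets cardinality.

Set Implicit Arguments.
Unset Strict Implicit.
Unset Printing Implicit Defensive.

Local Open Scope classical_set_scope.

Definition is_least (A : set nat) (n : nat) : Prop :=
  A n /\ forall k, A k -> n <= k.

Definition is_greatest (A : set nat) (n : nat) : Prop :=
  A n /\ forall k, A k -> k <= n.

Definition submonoid (S : set nat) : Prop :=
  S 0 /\ forall x y, S x -> S y -> S (x + y).

Definition numerical_semigroup (S : set nat) : Prop :=
  submonoid S /\ finite_set (~` S).

Definition is_multiplicity (S : set nat) (m : nat) : Prop :=
  is_least (S `&` [set n | 0 < n]) m.

(* The Frobenius number of [setT], usually -1, does not exist here. *)
Definition is_frobenius (S : set nat) (F : nat) : Prop :=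
  is_greatest (~` S) F.

(* Relational, since [setT] has no ratio. *)
Definition is_ratio (S : set nat) (q : nat) : Prop :=
  exists2 m, is_multiplicity S m & is_least (S `\` [set n | m %| n]) q.

Definition irreducible_semigroup (S : set nat) : Prop :=
  numerical_semigroup S /\
  ~ exists S1 S2, [/\ numerical_semigroup S1, numerical_semigroup S2,
                      S `<` S1, S `<` S2 & S = S1 `&` S2].

Definition generated (A : set nat) : set nat := smallest submonoid A.

Definition minimal_generators (S A : set nat) : Prop :=
  generated A = S /\ forall B, B `<` A -> generated B <> S.

(* [F < 2 * q] is q > F/2 in the rationals. *)
Definition is_C (m F : nat) (S : set nat) : Prop :=
  [/\ irreducible_semigroup S, is_frobenius S F, is_multiplicity S m
    & exists2 q, is_ratio S q & F < 2 * q].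

(* Main.v *)
(** Write C for the set of multiples of m together with the x > F/2 such that
    x > F or x is not congruent to F modulo m.  It contains F - x whenever
    x <= F lies outside C and 2x <> F, so every semigroup properly containing C
    contains F; hence C is irreducible.  Conversely a semigroup S with
    Frobenius number F, multiplicity m and ratio > F/2 is contained in C, and if
    the inclusion were proper, S would be the intersection of C and S + {F}.
    For the generators let w be the least integer > F/2.  The elements of C
    in [w, w + m) that m does not divide are not sums of two nonzero elements of
    C, and together with m they produce all of C except possibly the F + km with
    k > 0; these are obtained once F + m is a sum of two elements of the window,
    which fails only for m = 2 and for m = 3 with F even. *)

Require Import Defs.
From mathcomp Require Import all_boot.
From mathcomp Require Import classical_sets cardinality.
From mathcomp Require Import boolp zify.

Local Open Scope classical_set_scope.

(** * Congruences and general numerical semigroups *)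

Lemma eqmod_le_addM {m x y : nat} :
  x = y %[mod m] -> x <= y -> exists k, y = x + k * m.
Proof.
move=> /eqP exy xy; move: exy; rewrite eq_sym eqn_mod_dvd// => /dvdnP[k ek].
by exists k; rewrite -ek subnKC.
Qed.

Lemma eqmod_inj {m x y : nat} :
  x = y %[mod m] -> x < y + m -> y < x + m -> x = y.
Proof.
by move=> exy xy yx; case: (leqP x y) => [|/ltnW] le;
  [have [[|k] ek] := eqmod_le_addM exy le
  |have [[|k] ek] := eqmod_le_addM (esym exy) le]; lia.
Qed.

Lemma eqmod_addr {m x y} z : (x + z = y + z %[mod m]) <-> (x = y %[mod m]).
Proof.
by split=> [/eqP|/eqP e]; [rewrite eqn_modDr => /eqP|apply/eqP; rewrite eqn_modDr].
Qed.

Lemma eqmod_dvd_addl {m x} y : m %| x -> x + y = y %[mod m].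
Proof. by move=> /eqP dx; rewrite -modnDml dx. Qed.

Lemma submonoid_mul (T : set nat) a k : submonoid T -> T a -> T (k * a).
Proof.
by move=> [T0 TD] Ta; elim: k => [|k IHk]; rewrite ?mul0n// mulSn; apply: TD.
Qed.

Lemma finite_setC_bounded (S : set nat) F :
  (forall x, F < x -> S x) -> finite_set (~` S).
Proof.
move=> SF; apply: (@sub_finite_set _ _ `I_F.+1) => // x Sx.
by rewrite /= ltnS leqNgt; apply/negP => /SF.
Qed.

Lemma semigroup_setU_frobenius (S : set nat) F :
  numerical_semigroup S -> is_frobenius S F ->
  numerical_semigroup (S `|` [set F]).
Proof.
move=> [[S0 SD] _] [nSF maxF].
have SF x : F < x -> S x.
  by move=> Fx; apply: contrapT => /maxF; rewrite leqNgt Fx.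
have SUF x : F <= x -> (S `|` [set F]) x.
  by rewrite leq_eqVlt => /predU1P[->|/SF]; [right|left].
split; last by apply: (@finite_setC_bounded _ F) => x /SF; left.
split; first by left.
move=> x y [Sx|->] [Sy|->]; [by left; apply: SD|by apply: SUF; lia..].
Qed.

(** If [B] misses some [a] in [A], then [S] without [a] is a submonoid containing [B], since [a] is
    not a sum of two positive elements of [S]. *)
Lemma minimal_generators_atoms (S A : set nat) :
    submonoid S -> A `<=` S ->
    (forall T, submonoid T -> A `<=` T -> S `<=` T) ->
    (forall a, A a -> 0 < a /\
       forall s t, S s -> S t -> 0 < s -> 0 < t -> s + t <> a) ->
  minimal_generators S A.
Proof.
move=> [S0 SD] AS SA atomA; split.
  rewrite /generated; apply/seteqP; split; first exact: smallest_sub.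
  by move=> x Sx T [mT AT]; apply: SA Sx.
move=> B [BA nAB] genB.
have [a Aa nBa] : exists2 a, A a & ~ B a.
  by apply: contrapT => h; apply: nAB => a Aa; apply: contrapT => nBa;
    apply: h; exists a.
have [a_gt0 atom_a] := atomA _ Aa.
suff SDa : S `<=` S `\ a by have [_ /(_ erefl)] := SDa a (AS _ Aa).
rewrite -[X in X `<=` _]genB; apply: smallest_sub; last first.
  by move=> b Bb; split; [exact/AS/BA|move=> /= eba; apply: nBa; rewrite -eba].
split; first by split=> //= a0; rewrite -a0 in a_gt0.
move=> x y [Sx xa] [Sy ya]; split; first exact: SD.
case: (posnP x) => [->|x0]; first by rewrite add0n.
case: (posnP y) => [->|y0]; first by rewrite addn0.
exact: atom_a.
Qed.

(** * Existence and uniqueness of C(m, F) *)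

Definition semigroupC (m F : nat) : set nat :=
  [set x | m %| x \/ F < 2 * x /\ (F < x \/ x <> F %[mod m])].

Section SemigroupC.
Context {m F : nat}.
Hypotheses (m_gt0 : 0 < m) (F_ge3 : 3 <= F) (m_le : 2 * m <= F + 2).
Hypothesis m_ndvd : ~~ (m %| F).

Let C := semigroupC m F.

Lemma submonoid_semigroupC : submonoid C.
Proof.
split; first by left; exact: dvdn0.
have mulD x y : m %| x -> C y -> C (x + y).
  move=> dx [dy|[Fy hy]]; [by left; exact: dvdn_add|right; split; first lia].
  by case: hy => [?|ny]; [left; lia|right; rewrite eqmod_dvd_addl].
move=> x y Cx Cy; case: (Cx) => [dx|[Fx _]]; first exact: mulD.
case: Cy => [dy|[Fy _]]; last by right; split; [lia|left; lia].
by rewrite addnC; apply: mulD.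
Qed.

Lemma semigroupC_gt x : F < x -> C x.
Proof. by move=> Fx; right; split; [lia|left]. Qed.

Lemma numerical_semigroupC : numerical_semigroup C.
Proof.
split; first exact: submonoid_semigroupC.
exact: finite_setC_bounded semigroupC_gt.
Qed.

Lemma semigroupC_frobenius : is_frobenius C F.
Proof.
split; last first.
  by move=> k /= nCk; rewrite leqNgt; apply/negP => /semigroupC_gt.
by case=> [|[_ []]]; [exact/negP|rewrite ltnn|].
Qed.

Lemma semigroupC_multiplicity : is_multiplicity C m.
Proof.
split; first by split=> //; left.
(* If [F < 2 * k], then [2 * m <= F + 2 <= 2 * k + 1], so [m <= k]. *)
move=> k [[dk|[Fk _]] /= k0]; [exact: dvdn_leq|lia].
Qed.

(** Above F/2, lying outside [C] forces [x] to be congruent to [F], so [m] divides [F - x]. Below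
    F/2, a congruence of [F - x] with [F] would make [m] divide [x]. *)
Lemma semigroupC_sym x : x <= F -> 2 * x <> F -> ~ C x -> C (F - x).
Proof.
move=> xF x2 nCx; have [Fx|xF2] := ltnP F (2 * x).
  left; rewrite -eqn_mod_dvd// eq_sym; apply/eqP; apply: contrapT => nx.
  by apply: nCx; right; split=> //; right.
right; split; [lia|right=> e; apply: nCx; left].
have : F - x + 0 = F - x + x %[mod m] by rewrite addn0 subnK.
by rewrite ![F - x + _]addnC => /eqmod_addr /esym /eqP; rewrite mod0n.
Qed.

Lemma semigroupC_irreducible : irreducible_semigroup C.
Proof.
have [nCF _] := semigroupC_frobenius.
have memF T : numerical_semigroup T -> C `<` T -> T F.
  move=> [[_ TD] _] [CT nTC].
  have [z Tz nCz] : exists2 z, T z & ~ C z.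
    by apply: contrapT => h; apply: nTC => z Tz; apply: contrapT => nCz;
      apply: h; exists z.
  have [F2|/eqP F2] := eqVneq (2 * z) F; first by rewrite -F2 mul2n -addnn; apply: TD.
  have zF : z <= F by rewrite leqNgt; apply/negP => /semigroupC_gt.
  by rewrite -(subnK zF); apply: TD => //; apply: CT; apply: semigroupC_sym.
split; first exact: numerical_semigroupC.
move=> [S1 [S2 [nS1 nS2 CS1 CS2 eC]]]; apply: nCF; rewrite eC.
by split; apply: memF.
Qed.

Lemma semigroupC_is_C : is_C m F C.
Proof.
split; [exact: semigroupC_irreducible|exact: semigroupC_frobenius
       |exact: semigroupC_multiplicity|].
pose P x := `[< (C `\` [set n | m %| n]) x >].
have exP : exists x, P x.
  exists (F + m); apply/asboolP; split; first by apply: semigroupC_gt; lia.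
  by rewrite /= dvdn_addl//; apply/negP.
case: (ex_minnP exP) => q /asboolP Cq minq; exists q.
  exists m; first exact: semigroupC_multiplicity.
  by split=> // k Ck; apply: minq; apply/asboolP.
by case: Cq => -[//|[]].
Qed.

Lemma is_C_eq S : is_C m F S -> S = C.
Proof.
move=> [[nS irrS] frobS multS [q [m' multm' [_ minq]] Fq]].
have [[_ SD] _] := nS; have [nSF maxF] := frobS; have [[Sm _] _] := multS.
have em : m' = m.
  by apply/eqP; rewrite eqn_leq; apply/andP; split; [apply: multm'.2|apply: multS.2];
    [apply: multS.1|apply: multm'.1].
rewrite {m' multm'}em in minq.
have SC : S `<=` C.
  move=> x Sx; have [dx|ndx] := boolP (m %| x); [by left|right].
  have qx : q <= x by apply: minq; split=> //; apply/negP.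
  split; first lia.
  (* If [x <= F] were congruent to [F], adding multiples of [m] would put [F] in [S]. *)
  have [Fx|xF] := ltnP F x; [by left|right=> e; apply: nSF].
  have [k ->] := eqmod_le_addM e xF; apply: SD => //.
  exact: submonoid_mul nS.1 Sm.
apply: contrapT => nSC; apply: irrS; exists C, (S `|` [set F]); split.
- exact: numerical_semigroupC.
- exact: semigroup_setU_frobenius.
- by split=> // CS; apply: nSC; apply/seteqP.
- by split; [exact: subsetUl|move=> /(_ F (or_intror erefl))].
- apply/seteqP; split=> [x Sx|x [Cx [//|xF]]].
    by split; [exact: SC|left].
  by have [/(_ (eq_ind _ C Cx _ xF))] := semigroupC_frobenius.
Qed.

(** * Minimal generators of C(m, F) *)

Lemma semigroupC_generators_window w :
    (forall y, (F < 2 * y) = (w <= y)) ->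
    let W := [set y | [/\ w <= y < w + m, ~~ (m %| y) & y <> F %[mod m]]] in
    (exists a b, [/\ W a, W b & a + b = F + m]) ->
  minimal_generators C ([set m] `|` W).
Proof.
move=> Hw W [a [b [Wa Wb abFm]]].
have wm : m <= w by have := Hw w; lia.
apply: minimal_generators_atoms.
- exact: submonoid_semigroupC.
- move=> y [->|[/andP[wy _] _ nyF]]; first by left.
  by right; rewrite Hw; split=> //; right.
- move=> T mT AT x; have Tm : T m by apply: AT; left.
  have TM k : T (k * m) by exact: submonoid_mul.
  have [_ TD] := mT.
  have [/dvdnP[k ->] _|ndx] := boolP (m %| x); first exact: TM.
  move=> [|[]]; first by move=> dx; rewrite dx in ndx.
  rewrite Hw => wx xF; pose y := w + (x - w) %% m.
  have ex : x = y + (x - w) %/ m * m by have := divn_eq (x - w) m; rewrite /y; lia.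
  have exy : x = y %[mod m] by rewrite ex addnC modnMDl.
  have [eyF|/eqP nyF] := eqVneq (y %% m) (F %% m).
    have Fx : F <= x by case: xF => [/ltnW//|]; rewrite exy eyF.
    (* As [x] is not [F], it is [F + m + k * m], that is [a + b + k * m]. *)
    have [[|k] ek] := eqmod_le_addM (esym (etrans exy eyF)) Fx.
      by case: xF; rewrite ek mul0n addn0 ?ltnn.
    rewrite ek mulSn addnA -abFm; apply: (TD) => //.
    by apply: TD; apply: AT; right.
  rewrite ex; apply: TD => //; apply: AT; right; split=> //.
    by rewrite /y leq_addr ltn_add2l ltn_mod.
  apply: contra ndx => dy; rewrite ex dvdn_addr//; exact: dvdn_mull.
- move=> y Ay; split.
    by case: Ay => [->//|[_ + _]]; case: (y); rewrite ?dvdn0.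
  move=> s t Cs Ct s0 t0 sty.
  (* Hence a sum of two positive elements is at least [2 * m], and at least [w + m] unless [m]
     divides both. *)
  have geC u : C u -> 0 < u -> m <= u /\ (m %| u \/ w <= u).
    move=> Cu u0; split; first exact: semigroupC_multiplicity.2.
    by case: Cu => [|[]]; rewrite ?Hw; [left|right].
  have [ms hs] := geC s Cs s0; have [mt ht] := geC t Ct t0.
  case: Ay => [em|[yw ndy _]]; first by move: em => /=; lia.
  case: hs => [ds|ws]; last by lia.
  case: ht => [dt|wt]; last by lia.
  by rewrite -sty dvdn_add in ndy.
Qed.

(** Here c is 1 or 2 according to the parity of F, which treats (a) and (b)
    uniformly; c + 2 <= m leaves at least three values for x in [0, m - c], so
    that some x avoids both m - r and r - c, and then so does m - c - x. *)
Lemma semigroupC_generators c w r :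
    1 <= c <= 2 -> F + c = 2 * w -> c + 2 <= m -> c <= r <= m ->
    w = r %[mod m] ->
  minimal_generators C
    ([set m] `|` [set w + x | x in [set x | [/\ x < m, x + r <> m & x + c <> r]]]).
Proof.
move=> c12 Fcw cm crm wr.
(* [w + x] is congruent to [x + r], which lies strictly between 0 and [2 * m]. *)
have dvdW x : x < m -> (m %| w + x) = (x + r == m).
  move=> xm; rewrite /dvdn -modnDml wr modnDml; apply/eqP/eqP => [|rxm].
    by rewrite -(modnn m) => /eqmod_inj => e; rewrite addnC e; lia.
  by rewrite addnC rxm modnn.
(* Adding [c] turns [F] into [2 * w], which leaves [x + c] congruent to [r]; these differ by less
   than [m] because [c <= r]. *)
have modW x : x < m -> (w + x = F %[mod m]) <-> (x + c = r).
  move=> xm; have e : w + x + c = w + (x + c) by rewrite addnA.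
  split=> [/(eqmod_addr c)|xcr].
    rewrite e Fcw mul2n -addnn ![w + _]addnC => /eqmod_addr.
    by rewrite wr => /eqmod_inj; apply; lia.
  apply/(eqmod_addr c); rewrite e xcr Fcw mul2n -addnn ![w + _]addnC.
  exact/eqmod_addr/esym.
pose W := [set y | [/\ w <= y < w + m, ~~ (m %| y) & y <> F %[mod m]]].
have memW x : x < m -> W (w + x) <-> x + r <> m /\ x + c <> r.
  move=> xm; split=> [[_ ]|[xr xc]].
    by rewrite dvdW// => /eqP xr xF; split=> // /(modW _ xm).
  split; [lia|by rewrite dvdW//; apply/eqP|by move=> /(modW _ xm)].
have -> : [set w + x | x in [set x | [/\ x < m, x + r <> m & x + c <> r]]] = W.
  apply/seteqP; split=> [_ [x [xm xr xc] <-]|y Wy]; first exact/(memW x xm).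
  have [wy _ _] := Wy; have xm : y - w < m by lia.
  have ey : w + (y - w) = y by lia.
  by rewrite -ey in Wy; have [xr xc] := (memW _ xm).1 Wy; exists (y - w).
apply: semigroupC_generators_window; first by move=> y; lia.
have [x [xm xr xc]] : exists x, [/\ x + c <= m, x + r <> m & x + c <> r].
  have : (0 + r <> m /\ 0 + c <> r) \/ (1 + r <> m /\ 1 + c <> r)
         \/ (2 + r <> m /\ 2 + c <> r) by lia.
  by case=> [|[]] [hr hc]; [exists 0|exists 1|exists 2]; split=> //; lia.
(* The sum is [2 * w + m - c = F + m], and the reflection of [x] to [m - c - x] exchanges the two
   excluded values. *)
exists (w + x), (w + (m - c - x)); split; last lia.
  by apply/memW; [lia|].
by apply/memW; [lia|split; lia].
Qed.

(** The window from [f + 1] to [f + 3] contributes only [f + 3], whose double is [F + 6]; so [F + 3]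
    has to be a generator itself. *)
Lemma semigroupC_generators3 f :
  m = 3 -> F = 2 * f -> minimal_generators C [set 3; f + 3; F + 3].
Proof.
move=> m3 F2f.
have memC x : C x <-> x %% 3 = 0 \/ f < x /\ (F < x \/ x %% 3 <> F %% 3).
  have e : (F < 2 * x) = (f < x) by rewrite F2f; lia.
  rewrite /C /semigroupC /= m3 e.
  by split=> -[h|h]; by [left; apply/eqP|right].
have nF : F %% 3 <> 0 by apply/eqP; rewrite -m3.
apply: minimal_generators_atoms.
- exact: submonoid_semigroupC.
- by move=> y [[]|] ->; apply/memC; lia.
- move=> T mT AT x /memC Cx; have [_ TD] := mT.
  have T3 : T 3 by apply: AT; left; left.
  have TM k : T (k * 3) by exact: submonoid_mul.
  have [x0|x0] := eqVneq (x %% 3) 0.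
    by have -> : x = x %/ 3 * 3 by lia.
  have [xF|xF] := eqVneq (x %% 3) (F %% 3).
    have -> : x = F + 3 + (x - F - 3) %/ 3 * 3 by lia.
    by apply: TD => //; apply: AT; right.
  have -> : x = f + 3 + (x - f - 3) %/ 3 * 3 by lia.
  by apply: TD => //; apply: AT; left; right.
- move=> a Aa; split; first by case: Aa => [[]|] -> /=; lia.
  move=> s t /memC Cs /memC Ct s0 t0.
  by case: Aa => [[]|] -> /=; lia.
Qed.

End SemigroupC.

(** For odd [F] and [m = 2] both offsets 0 and 1 would be removed, leaving 2 as the only generator;
    hence [m <> 2] in (a). *)
Theorem proposition16 (m F : nat) (m_gt0 : 0 < m) (F_gt0 : 0 < F)
    (F_ge3 : 3 <= F) (m_le : 2 * m <= F + 2) (m_ndvd : ~~ (m %| F)) :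
  (exists! C : set nat, is_C m F C) /\
  forall C : set nat, is_C m F C ->
    (odd F -> m <> 2 -> forall r : nat,
       is_least [set k | 1 <= k <= m /\ (F + 1) %/ 2 = k %[mod m]] r ->
       minimal_generators C
         ([set m] `|`
          [set (F + 1) %/ 2 + x | x in
             [set x | [/\ x < m, x + r <> m & x + 1 <> r]]])) /\
    (~~ odd F -> forall r : nat,
       is_least [set k | 1 <= k <= m /\ (F + 2) %/ 2 = k %[mod m]] r ->
       (m = 3 -> minimal_generators C [set 3; F %/ 2 + 3; F + 3]) /\
       (m <> 3 ->
        minimal_generators C
          ([set m] `|`
           [set (F + 2) %/ 2 + x | x in
              [set x | [/\ x < m, x + r <> m & x + 2 <> r]]]))).
Proof.
have eqC C := @is_C_eq m F m_gt0 F_ge3 m_le m_ndvd C.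
split.
  exists (semigroupC m F); split; first exact: semigroupC_is_C.
  by move=> S /eqC.
move=> C /eqC ->; split=> [Fodd m2 r [[rm er] _]|Feven r [[rm er] _]].
  have m1 : m <> 1 by move=> e; rewrite e dvd1n in m_ndvd.
  by apply: semigroupC_generators => //; lia.
split=> m3.
  rewrite m3 in m_ndvd *; apply: semigroupC_generators3 => //; lia.
have m1 : m <> 1 by move=> e; rewrite e dvd1n in m_ndvd.
have m2 : m <> 2 by move=> e; move: m_ndvd; rewrite e dvdn2 Feven.
(* This gives [c <= r] for [c = 2]: if [r = 1], then [m] divides [F %/ 2], hence [F]. *)
have r1 : r <> 1.
  move=> e; rewrite {}e in er; have e1 : (F + 2) %/ 2 = F %/ 2 + 1 by lia.
  have : F %/ 2 + 1 = 0 + 1 %[mod m] by rewrite -e1.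
  move=> /eqmod_addr; rewrite mod0n => /eqP dF; move: m_ndvd.
  have -> : F = F %/ 2 * 2 by lia.
  by rewrite dvdn_mulr.
by apply: semigroupC_generators => //; lia.
Qed.
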